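(* Let $n \ge 4$ and let $\rho: B_{n+1} \to GL_{n+1}(\mathbb{C})$ be an irreducible representation of $B_{n+1}$ of dimension $n+1$. Suppose that there is a nonzero vector $v \in \mathbb{C}^{n+1}$ such that the one-dimensional subspace $\mathbb{C}v$ is invariant under $\rho(\sigma_1), \dots, \rho(\sigma_{n-2})$ and $\rho(\sigma_n)$ (i.e. under the restriction of $\rho$ to the subgroup $B_{n-1} \times \langle \sigma_n \rangle$ generated by $\sigma_1,\dots,\sigma_{n-2},\sigma_n$). Then there exists $y \in \mathbb{C}^*$ such that $\mathrm{rank}(\rho(\sigma_1) - yI) = 2$. *)

(* Defs.v *)
From HB Require Import structures.
From mathcomp Require Import all_boot all_order all_algebra.
From mathcomp Require Import complex.
From mathcomp Require Import Rstruct.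
From Stdlib Require Reals.
Set Implicit Arguments. Unset Strict Implicit. Unset Printing Implicit Defensive.
Import GRing.Theory Num.Theory.
Local Open Scope ring_scope.

Notation C := (complex Rdefinitions.R).

(* A representation rho of the braid group B_{n+1} (Artin generators
   sigma_1, ..., sigma_n) on C^{d} is, by the standard presentation of
   B_{n+1}, the same as a family of invertible matrices A 1, ..., A n
   (A i = rho(sigma_i); values at other indices are irrelevant) satisfying
   the braid relations.  Matrices act on column vectors v by A *m v. *)
Definition braid_rep (n d : nat) (A : nat -> 'M[C]_d) : Prop :=
  [/\ (forall i, (1 <= i <= n)%N -> A i \in unitmx),
      (forall i, (1 <= i)%N -> (i.+1 <= n)%N ->
          A i *m A i.+1 *m A i = A i.+1 *m A i *m A i.+1)
    & (forall i j, (1 <= i)%N -> (j <= n)%N -> (i.+1 < j)%N ->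
          A i *m A j = A j *m A i)].

(* A subspace W of C^d (column vectors) is encoded as the row space of a
   matrix U whose rows are the transposes of spanning vectors of W.
   W is invariant under M (M W <= W) iff (U *m M^T <= U)%MS. *)
Definition col_invariant (d : nat) (M U : 'M[C]_d) : bool :=
  (U *m M^T <= U)%MS.

(* Irreducibility: no invariant subspace other than 0 and C^d under all
   rho(sigma_i) (equivalently under the whole group, as the matrices are
   invertible and the space finite-dimensional). *)
Definition braid_rep_irreducible (n d : nat) (A : nat -> 'M[C]_d) : Prop :=
  forall U : 'M[C]_d,
    (forall i, (1 <= i <= n)%N -> col_invariant (A i) U) ->
    (\rank U == 0)%N || (\rank U == d).

(* Main.v *)
Require Import Defs.
From HB Require Import structures.
From mathcomp Require Import all_boot all_order all_algebra.
From mathcomp Require Import complex Rstruct.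
From mathcomp Require Import ring zify.

(** Let [N = n + 1] and let [y] be the common eigenvalue of
    [sigma_1, ..., sigma_(n-2)] on [v].  The rotation
    [sigma_1 ... sigma_n] conjugates the generators cyclically, so they extend
    to a family [T i = sigma_i - y] indexed by [Z/N], and the rotated vectors
    [w i] of [v] satisfy [w i * T j = 0] unless [j] is one of [i - 1], [i],
    [i + 1] (we transpose, so matrices act on row vectors on the right).

    If some nonzero vector is killed by all [T j] but two consecutive ones, its
    rotations that are killed by a given [T j] are linearly independent: a
    relation between them propagates zero coefficients around the circle.  There
    are [N - 2] of them, so [T j] has rank at most 2.  Otherwise the same
    propagation shows that the [N - 3] vectors [w i] killed by [T j] are
    independent; if [T j] had rank at least 3 they would span its kernel.
    Commutation then forces the span of all [w i] to be invariant, hence the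
    [w i] form a basis, and [T j * T (j + 2) = T (j + 2) * T j] evaluated at
    [w (j + 1)] makes every line [w i] invariant, a contradiction.  Finally the
    rank is at least 2 because the images of [T 1, ..., T n] span. *)

Set Implicit Arguments. Unset Strict Implicit. Unset Printing Implicit Defensive.
Import GRing.Theory Num.Theory.
Local Open Scope ring_scope.

(** * Cyclic indices and linear combinations of rows *)

Lemma Zp_shift_neq m (k : 'I_m.+2) (a b : nat) :
  (a < b)%N -> (b < a + m.+2)%N -> k + a%:R != k + b%:R.
Proof.
move=> ab ba; rewrite (inj_eq (addrI k)) -(subnK (ltnW ab)) natrD.
rewrite -subr_eq0 opprD addrCA subrr addr0 oppr_eq0.
apply/eqP; rewrite Zp_nat => /(congr1 val) /=.
by rewrite modn_small; lia.
Qed.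

(** Meant for [c] the coefficients of a linear relation between rows: multiplying that relation by
    one [T j] yields the recurrence. *)
Lemma cyclic_zero (F : fieldType) m (c : 'I_m.+2 -> F) (i0 : 'I_m.+2) :
  (forall i, c i = 0 -> c (i + 1) = 0 -> c (i + 1 + 1) = 0) ->
  c i0 = 0 -> c (i0 + 1) = 0 -> forall i, c i = 0.
Proof.
move=> step h0 h1 i.
have H k : c (i0 + k%:R) = 0 /\ c (i0 + k%:R + 1) = 0.
  elim: k => [|k [IH0 IH1]]; first by rewrite addr0.
  by rewrite -natr1 addrA; split=> //; apply: step.
have [] := H (val (i - i0)).
by rewrite natr_Zp addrC subrK.
Qed.

Lemma rows_mulmx (F : fieldType) p q r (c : 'rV[F]_p) (w : 'I_p -> 'rV[F]_q)
    (T : 'M[F]_(q, r)) :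
  c *m (\matrix_i w i) *m T = \sum_i c 0 i *: (w i *m T).
Proof.
rewrite -mulmxA mulmx_sum_row; apply: eq_bigr => i _.
by rewrite row_mul rowK.
Qed.

(** * Rank and kernel of a matrix that kills independent rows *)

Section KilledRows.
Context (F : fieldType) (N : nat) (P : pred 'I_N) (w : 'I_N -> 'rV[F]_N)
  (T : 'M[F]_N).
Hypothesis indep : forall c : 'rV[F]_N, c *m (\matrix_i w i) = 0 ->
  (forall i, ~~ P i -> c 0 i = 0) -> c = 0.
Hypothesis killed : forall i, P i -> w i *m T = 0.

Let f (k : 'I_#|P|) : 'I_N := enum_val k.
(** Right multiplication by [E] extends a row indexed by [P] by zeros, so the rows of
    [E *m \matrix_i w i] are the [w i] with [P i]. *)
Let E : 'M[F]_(#|P|, N) := rowsub f 1%:M.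

Let E_out (c : 'rV[F]_#|P|) i : ~~ P i -> (c *m E) 0 i = 0.
Proof.
move=> nPi; rewrite mxE big1 // => k _; rewrite !mxE.
case: eqP => [e|_]; last by rewrite mulr0.
by move: (enum_valP k); rewrite -/(f k) e unfold_in (negPf nPi).
Qed.

Let E_in (c : 'rV[F]_#|P|) k : (c *m E) 0 (f k) = c 0 k.
Proof.
rewrite mxE (bigD1 k) //= !mxE eqxx mulr1 big1 ?addr0 // => l /negPf nlk.
by rewrite !mxE (inj_eq enum_val_inj) nlk mulr0.
Qed.

Let free_W : row_free (E *m \matrix_i w i).
Proof.
apply: inj_row_free => c; rewrite mulmxA => h.
have e : c *m E = 0 by apply: indep => // i; apply: E_out.
by apply/rowP => k; rewrite -E_in e !mxE.
Qed.

Let kill_W : (E *m \matrix_i w i) *m T = 0.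
Proof.
apply/row_matrixP => k; rewrite /E mul_rowsub_mx mul1mx mul_rowsub_mx.
rewrite row_rowsub row_mul rowK row0 killed //.
exact: enum_valP k.
Qed.

Lemma killed_rows_rank : (#|P| + \rank T <= N)%N.
Proof.
by have := mulmx0_rank_max kill_W; rewrite (eqP free_W).
Qed.

(** The bound on [N] makes the kernel no larger than the number of independent killed rows, which
    therefore span it. *)
Lemma killed_rows_kernel (x : 'rV[F]_N) : (N <= #|P| + \rank T)%N ->
  x *m T = 0 ->
  exists2 c : 'rV[F]_N, x = c *m (\matrix_i w i) &
    forall i, ~~ P i -> c 0 i = 0.
Proof.
move=> hN /sub_kermxP xT.
have sub : (E *m (\matrix_i w i) <= kermx T)%MS by apply/sub_kermxP.
have : (kermx T <= E *m (\matrix_i w i))%MS.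
  rewrite -(geq_leqif (mxrank_leqif_sup sub)) mxrank_ker (eqP free_W).
  by rewrite leq_subLR addnC.
move/(submx_trans xT)/submxP => [d ->].
by exists (d *m E) => [|i]; [rewrite mulmxA | apply: E_out].
Qed.

End KilledRows.

(** * Non-adjacency on the circle *)

Definition far m (i j : 'I_m.+2) := [&& i != j, i != j + 1 & j != i + 1].

Lemma far_sym m (i j : 'I_m.+2) : far i j = far j i.
Proof. by rewrite /far eq_sym [X in _ && X]andbC. Qed.

(** Gaps 2 and 3 both give non-adjacent points because the circle has at least five points. *)
Lemma far_shift m (k : 'I_m.+4.+1) (a b : nat) :
  (a.+1 < b)%N -> (b < a + 4)%N -> far (k + a%:R) (k + b%:R).
Proof.
move=> ab ba; rewrite /far -!addrA !natr1.
apply/and3P; split; [ | | rewrite eq_sym]; by apply: Zp_shift_neq; lia.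
Qed.

Lemma card_far m (j : 'I_m.+2) : (m.+2 <= #|[pred i | far i j]| + 3)%N.
Proof.
rewrite -[X in (X <= _)%N]card_ord -(cardC [pred i | far i j]) leq_add2l.
apply: leq_trans (card_size [:: j; j + 1; j - 1]).
apply/subset_leq_card/subsetP => i.
by rewrite !inE /far !negb_and !negbK -(subr_eq j) [_ == i]eq_sym.
Qed.

(** * Vectors killed by most of the [T j] *)

Section CommonKernels.
Context (F : fieldType) (m : nat).
Local Notation N := m.+4.+1.
Context (T : 'I_N -> 'M[F]_N).

(** Multiplying a relation by [T (i + 1)] leaves only the terms at [i + 1] and [i + 2], so a zero
    coefficient passes to the next index. *)
Lemma rank_le2_of_killed (e : 'I_N -> 'rV[F]_N) (j : 'I_N) :
  (forall i k, i != k -> i != k + 1 -> e i *m T k = 0) ->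
  (forall k, e (k + 1) *m T k != 0) ->
  (\rank (T j) <= 2)%N.
Proof.
move=> kill nz; pose P : pred 'I_N := [pred i | (i != j) && (i != j + 1)].
have cardP : (N <= #|P| + 2)%N.
  rewrite -[X in (X <= _)%N]card_ord -(cardC P) leq_add2l.
  apply: leq_trans (card_size [:: j; j + 1]).
  apply/subset_leq_card/subsetP => i.
  by rewrite !inE negb_and !negbK.
suff : (#|P| + \rank (T j) <= N)%N by move: cardP; lia.
apply: (@killed_rows_rank _ _ _ e) => [c cW c0|i /andP [ij ij1]]; last exact: kill.
apply/rowP => i; rewrite mxE; move: i.
apply: (@cyclic_zero _ _ (fun i => c 0 i) j).
- move=> i _ ci1; apply/eqP.
  have := rows_mulmx c e (T (i + 1)); rewrite cW mul0mx.
  rewrite (bigD1 (i + 1 + 1)) //= big1 ?addr0 => [/esym/eqP|k hk].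
    by rewrite scaler_eq0 (negPf (nz _)) orbF.
  have [->|ki] := eqVneq k (i + 1); first by rewrite ci1 scale0r.
  by rewrite kill ?scaler0.
- by apply: c0; rewrite /P /= eqxx.
- by apply: c0; rewrite /P /= eqxx andbF.
Qed.

Hypothesis comm : forall i j, far i j -> T i *m T j = T j *m T i.
Hypothesis irr : forall U : 'M[F]_N, U != 0 ->
  (forall j, U *m T j <= U)%MS -> \rank U = N.
Context (w : 'I_N -> 'rV[F]_N) (mu : F).
Hypothesis kill : forall i j, far i j -> w i *m T j = 0.
Hypothesis eigen : forall i, w i *m T i = mu *: w i.
Hypothesis nzr : forall i, w (i + 1) *m T i != 0.
Hypothesis nzl : forall i, w i *m T (i + 1) != 0.

Let W := \matrix_i w i.

(** Here the terms at [i], [i + 1] and [i + 2] survive [T (i + 1)], and [nzr] makes the third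
    coefficient vanish once the first two do. *)
Let indep j (c : 'rV[F]_N) : c *m W = 0 ->
  (forall i, ~~ far i j -> c 0 i = 0) -> c = 0.
Proof.
move=> cW c0; apply/rowP => i; rewrite mxE; move: i.
apply: (@cyclic_zero _ _ (fun i => c 0 i) j).
- move=> i ci0 ci1; apply/eqP.
  have := rows_mulmx c w (T (i + 1)); rewrite -/W cW mul0mx.
  rewrite (bigD1 (i + 1 + 1)) //= big1 ?addr0 => [/esym/eqP|k hk].
    by rewrite scaler_eq0 (negPf (nzr _)) orbF.
  have [->|ki1] := eqVneq k (i + 1); first by rewrite ci1 scale0r.
  have [->|ki] := eqVneq k i; first by rewrite ci0 scale0r.
  by rewrite kill ?scaler0 // /far ki1 hk (inj_eq (addIr 1)) eq_sym.
- by apply: c0; rewrite /far eqxx.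
- by apply: c0; rewrite /far eqxx andbF.
Qed.

Hypothesis rank3 : forall j, (3 <= \rank (T j))%N.

Let kernel j (x : 'rV[F]_N) : x *m T j = 0 ->
  exists2 c : 'rV[F]_N, x = c *m W & forall i, ~~ far i j -> c 0 i = 0.
Proof.
apply: (@killed_rows_kernel _ _ [pred i | far i j] w (T j)).
- by move=> c; apply: indep.
- by move=> i /kill.
- by apply: leq_trans (card_far j) _; rewrite leq_add2l.
Qed.

Let sub_kernel k (x : 'rV[F]_N) : x *m T k = 0 -> (x <= W)%MS.
Proof. by case/kernel=> c -> _; apply: submxMl. Qed.

Let commK x i k : far i k -> x *m T k = 0 -> x *m T i *m T k = 0 :> 'rV[F]_N.
Proof. by move=> /comm e h; rewrite -mulmxA e mulmxA h mul0mx. Qed.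

Let killr j k : far j k -> far (j + 1) k ->
  w (j + 1) *m T j *m T k = 0.
Proof. by move=> h h1; apply/commK/kill. Qed.

Let killl j k : far j k -> far (j + 1) k ->
  w j *m T (j + 1) *m T k = 0.
Proof. by move=> h h1; apply/commK/kill. Qed.

(** [j - 2] and [j + 3] serve as test indices: far from [j] and [j + 1], but next to [j - 1] and
    [j + 2] respectively. *)
Let far_down2 (j : 'I_N) : far j (j - 2%:R) /\ far (j + 1) (j - 2%:R).
Proof.
rewrite -!(far_sym (j - 2%:R)) -[X in far X _]addr0 -[X in _ /\ far X _]addr0.
have -> : j + 1 = j - 2%:R + 3%:R by ring.
have {2}-> : j = j - 2%:R + 2%:R by ring.
by split; apply: (@far_shift _ _ 0).
Qed.

Let far_up3 (j : 'I_N) : far j (j + 3%:R) /\ far (j + 1) (j + 3%:R).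
Proof.
split; last by apply: (@far_shift _ _ 1).
by rewrite -[X in far X]addr0; apply: (@far_shift _ _ 0).
Qed.

(** For adjacent [i] and [j], commutation shows that [w i *m T j] is killed by some [T k], hence
    lies in a kernel spanned by rows of [W]; irreducibility then applies to the row space. *)
Let W_unit : W \in unitmx.
Proof.
rewrite -row_full_unit; apply/eqP/irr.
  apply: contraNneq (nzr 0) => W0.
  by rewrite -(rowK w (0 + 1)) -/W W0 row0 mul0mx.
move=> j; apply/row_subP => i; rewrite row_mul rowK.
have [->|ij] := eqVneq i j.
  by rewrite eigen scalemx_sub // -(rowK w j) row_sub.
have [->|ij1] := eqVneq i (j + 1).
  have [h h1] := far_down2 j.
  exact: (sub_kernel (killr h h1)).
have [->|ji1] := eqVneq j (i + 1).
  have [h h1] := far_up3 i.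
  exact: (sub_kernel (killl h h1)).
by rewrite kill ?sub0mx // /far ij ij1.
Qed.

Let W_inj (c d : 'rV[F]_N) : c *m W = d *m W -> c = d.
Proof. by move/(can_inj (mulmxK W_unit)). Qed.

Let kernelW k (c : 'rV[F]_N) : c *m W *m T k = 0 ->
  forall i, ~~ far i k -> c 0 i = 0.
Proof. by case/kernel => d /W_inj ->. Qed.

(** Each coordinate outside [j] and [j + 1] is tested by one [k]: [j - 2] for [j - 1], [j + 3] for
    [j + 2], and the index itself otherwise. *)
Let two_terms j (x : 'rV[F]_N) :
  (forall k, far j k -> far (j + 1) k -> x *m T k = 0) ->
  exists a b, x = a *: w j + b *: w (j + 1).
Proof.
move=> xT.
have /submxP [c xE] : (x <= W)%MS.
  by have [h h1] := far_down2 j; apply: sub_kernel (xT _ h h1).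
have c0 i : i != j -> i != j + 1 -> c 0 i = 0.
  move=> ij ij1.
  have c0 k : far j k -> far (j + 1) k -> ~~ far i k -> c 0 i = 0.
    by move=> h h1; apply: kernelW; rewrite -xE; apply: xT.
  have [e|ji1] := eqVneq j (i + 1).
    have [h h1] := far_down2 j; apply: (c0 _ h h1).
    by rewrite /far e (_ : i + 1 - 2%:R + 1 = i) ?eqxx ?andbF //; ring.
  have [e|ij2] := eqVneq i (j + 1 + 1).
    have [h h1] := far_up3 j; apply: (c0 _ h h1).
    by rewrite /far e (_ : j + 3%:R = j + 1 + 1 + 1) ?eqxx ?andbF //; ring.
  apply: (c0 i); rewrite /far ?eqxx //.
    by rewrite eq_sym ij ji1.
  by rewrite eq_sym ij1 (inj_eq (addIr 1)) eq_sym ij.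
exists (c 0 j), (c 0 (j + 1)); rewrite xE mulmx_sum_row.
have jj1 : j + 1 != j.
  by rewrite -[X in _ != X]addr0 eq_sym; apply: (@Zp_shift_neq _ j 0 1).
rewrite (bigD1 j) //= (bigD1 (j + 1)) //= !rowK big1 ?addr0 // => i /andP [h h1].
by rewrite c0 // scale0r.
Qed.

Let pair_coef (i j : 'I_N) a b : i != j ->
  let c : 'rV[F]_N := a *: delta_mx 0 i + b *: delta_mx 0 j in
  [/\ c 0 i = a, c 0 j = b & c *m W = a *: w i + b *: w j].
Proof.
move=> ij; split.
- by rewrite !mxE !eqxx (negPf ij) mulr1 mulr0 addr0.
- by rewrite !mxE !eqxx eq_sym (negPf ij) mulr1 mulr0 add0r.
- by rewrite mulmxDl -!scalemxAl -!rowE !rowK.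
Qed.

Let neq1 (j : 'I_N) : j != j + 1.
Proof. by rewrite -[X in X != _]addr0; apply: (@Zp_shift_neq _ j 0 1). Qed.

Let coefr j : exists a b,
  b != 0 /\ w (j + 1) *m T j = a *: w j + b *: w (j + 1).
Proof.
have [a [b e]] := two_terms (@killr j); exists a, b; split=> //.
apply: contraNneq (nzr j) => b0; move: e; rewrite b0 scale0r addr0 => e.
(* If [b] is zero, [T j] kills [a *: w j - mu *: w (j + 1)], so by [kernelW] the coordinate [a] at
   [j] vanishes, against [nzr]. *)
have [ca _ cW] := pair_coef a (- mu) (neq1 j).
rewrite e -ca (@kernelW j) ?scale0r ?eqxx /far ?eqxx // cW.
rewrite mulmxDl -!scalemxAl eigen e !scalerA -scalerDl.
by rewrite mulNr mulrC subrr scale0r.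
Qed.

Let coefl j : exists a b,
  a != 0 /\ w j *m T (j + 1) = a *: w j + b *: w (j + 1).
Proof.
have [a [b e]] := two_terms (@killl j); exists a, b; split=> //.
apply: contraNneq (nzl j) => a0; move: e; rewrite a0 scale0r add0r => e.
have [_ cb cW] := pair_coef (- mu) b (neq1 j).
rewrite e -cb (@kernelW (j + 1)) ?scale0r ?eqxx /far ?eqxx // cW.
rewrite mulmxDl -!scalemxAl eigen e !scalerA -scalerDl.
by rewrite mulNr mulrC addNr scale0r.
Qed.

(* Evaluating both sides of [T j *m T (j + 2) = T (j + 2) *m T j] at
   [w (j + 1)] kills the off-diagonal coefficients. *)
Let diag j : exists d a, [/\ w (j + 1) *m T j = d *: w (j + 1)
  & w (j + 1) *m T (j + 1 + 1) = a *: w (j + 1)].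
Proof.
have [c [d [d0 er]]] := coefr j.
have [a [b [a0 el]]] := coefl (j + 1).
have f2 : far j (j + 1 + 1).
  by rewrite -[X in far X]addr0 -addrA; apply: (@far_shift _ _ 0 2).
have := comm f2 => /(congr1 (mulmx (w (j + 1)))).
rewrite !mulmxA er el !mulmxDl -!scalemxAl (kill f2) er el.
rewrite kill 1?far_sym // !scaler0 add0r addr0 !scalerDr !scalerA.
rewrite (mulrC a d) addrC => /addIr e.
have [] : a * c = 0 /\ d * b = 0.
  have n02 : j != j + 1 + 1 by case/and3P: f2.
  have [c1 c2 cW] := pair_coef (a * c) (- (d * b)) n02.
  have c0 : a * c *: delta_mx 0 j + - (d * b) *: delta_mx 0 (j + 1 + 1) = 0
      :> 'rV[F]_N.
    by apply: W_inj; rewrite mul0mx cW scaleNr e subrr.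
  by split; [rewrite -c1 c0 mxE | apply: oppr_inj; rewrite -c2 c0 mxE oppr0].
move/eqP; rewrite mulf_eq0 (negPf a0) => /eqP c0.
move/eqP; rewrite mulf_eq0 (negPf d0) => /eqP b0.
by exists d, a; rewrite c0 b0 !scale0r add0r addr0.
Qed.

(** By [diag] at [- 1], [w 0] is an eigenvector of both neighbours [T (- 1)] and [T 1], so its line
    is invariant. *)
Lemma not_all_rank3 : False.
Proof.
have inv : (forall j, w 0 *m T j <= w 0)%MS.
  have [d [a [ed ea]]] := diag (- 1); move: ed ea; rewrite addNr add0r => ed ea.
  move=> j; have [<-|nj0] := eqVneq 0 j; first by rewrite eigen scalemx_sub.
  have [e|nj1] := eqVneq 0 (j + 1).
    have -> : j = - 1 by apply/eqP; rewrite -addr_eq0 -e.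
    by rewrite ed scalemx_sub.
  have [->|nj2] := eqVneq j (0 + 1); first by rewrite add0r ea scalemx_sub.
  by rewrite kill ?sub0mx // /far nj0 nj1.
have w0 : w 0 != 0 by apply: contraNneq (nzl 0) => ->; rewrite mul0mx.
have : \rank <<w 0>>%MS = N.
  apply: irr => [|j]; first by rewrite -mxrank_eq0 genmxE mxrank_eq0.
  by rewrite (eqmxMr _ (genmxE _)) genmxE inv.
by rewrite genmxE => h; have := rank_leq_row (w 0); rewrite h.
Qed.

End CommonKernels.

(** * Rank bounds for a family permuted by a rotation *)

Section Rotation.
Context (F : fieldType) (m : nat).
Local Notation N := m.+4.+1.
Context (T : 'I_N -> 'M[F]_N) (t : 'M[F]_N).
Hypothesis t_unit : t \in unitmx.
Hypothesis rot : forall i, T i *m t = t *m T (i + 1).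
(** The index [- 1] stands for the extra element closing the circle; only the other indices come
    from Artin generators. *)
Hypothesis irr : forall U : 'M[F]_N, U != 0 ->
  (forall j : 'I_N, j != - 1 -> U *m T j <= U)%MS -> \rank U = N.

Let rotX i k : T i *m t ^+ k = t ^+ k *m T (i + k%:R).
Proof.
elim: k => [|k IH]; first by rewrite expr0 addr0 mul1mx mulmx1.
by rewrite exprSr -mulmxE mulmxA IH -mulmxA rot -natr1 addrA mulmxA.
Qed.

Let rotI (x : 'rV[F]_N) (s j : 'I_N) :
  x *m t ^+ s *m T j = x *m T (j - s) *m t ^+ s.
Proof. by rewrite -[RHS]mulmxA rotX natr_Zp subrK mulmxA. Qed.

Let tX_unit k : t ^+ k \in unitmx.
Proof. exact: unitrX. Qed.

Let mul_tX_eq0 (x : 'rV[F]_N) k : (x *m t ^+ k == 0) = (x == 0).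
Proof.
apply/eqP/eqP => [h|->]; last by rewrite mul0mx.
by rewrite -[x](mulmxK (tX_unit k)) h mul0mx.
Qed.

Let rank_rot j : \rank (T j) = \rank (T 0).
Proof.
have := rotX 0 j; rewrite natr_Zp add0r => e.
rewrite -(mxrankMfree (T 0) (B := t ^+ j)) ?row_free_unit // e.
by rewrite eqmxMfull // row_full_unit.
Qed.

Let line_absurd (x : 'rV[F]_N) : x != 0 ->
  (forall j : 'I_N, j != - 1 -> (x *m T j <= x)%MS) -> False.
Proof.
move=> x0 inv; have : \rank <<x>>%MS = N.
  apply: irr => [|j j1]; first by rewrite -mxrank_eq0 genmxE mxrank_eq0.
  by rewrite (eqmxMr _ (genmxE _)) genmxE inv.
by rewrite genmxE => h; have := rank_leq_row x; rewrite h.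
Qed.

(* Otherwise the sum of the images of the [T j] would be too small. *)
Lemma rank_gt1 : (1 < \rank (T 0%R))%N.
Proof.
rewrite ltnNge; apply/negP => rk1.
pose U : 'M[F]_N := (\sum_(j | j != - 1) <<T j>>)%MS.
have TU j : j != - 1 -> (T j <= U)%MS.
  by move=> j1; apply: (sumsmx_sup j) => //; rewrite genmxE.
have [U0|U0] := eqVneq U 0.
  apply: (@line_absurd (delta_mx 0 0)) => [|j /TU].
    by apply/eqP => /matrixP/(_ 0 0)/eqP; rewrite !mxE oner_eq0.
  by rewrite U0 submx0 => /eqP ->; rewrite mulmx0 sub0mx.
have : (\rank U < N)%N.
  apply: (@leq_ltn_trans (\sum_(j : 'I_N | j != - 1) 1)).
    apply: leq_trans (mxrank_sum_leqif _) _; apply: leq_sum => j _.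
    by rewrite /= genmxE rank_rot.
  rewrite sum1_card -[X in (_ < X)%N]card_ord.
  by rewrite -(cardC (pred1 (- 1 : 'I_N))) card1.
rewrite irr ?ltnn // => j j1.
by apply: submx_trans (submxMl _ _) (TU _ j1).
Qed.

Hypothesis comm : forall k, far 0 k -> T 0 *m T k = T k *m T 0.
Context (w0 : 'rV[F]_N) (mu : F).
Hypothesis w0_neq0 : w0 != 0.
Hypothesis kill : forall k, far 0 k -> w0 *m T k = 0.
Hypothesis eigen : w0 *m T 0 = mu *: w0.

Let far_sub (i j k : 'I_N) : far i j -> far (i - k) (j - k).
Proof.
by rewrite /far -!(addrAC _ 1 (- k)) !(inj_eq (addIr (- k))).
Qed.

Let comm_far i j : far i j -> T i *m T j = T j *m T i.
Proof.
move/(far_sub i); rewrite subrr => /comm e.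
have c x : t ^+ i *m T x = T (x - i) *m t ^+ i.
  by rewrite rotX natr_Zp subrK.
apply: (can_inj (mulKmx (tX_unit i))).
by rewrite !mulmxA !c -!mulmxA !c !mulmxA subrr e.
Qed.

(** A rotation moves [k] to [- 1], the index at which [irr] asks for no invariance, so a nonzero [x]
    would give an invariant line. *)
Let killed_by_all_but_one (x : 'rV[F]_N) k :
  (forall j, j != k -> x *m T j = 0) -> x = 0.
Proof.
move=> xT; apply/eqP; apply/negPn/negP => x0.
apply: (@line_absurd (x *m t ^+ (- 1 - k : 'I_N)%R)) => [|j j1].
  by rewrite mul_tX_eq0.
rewrite rotI xT ?mul0mx ?sub0mx //.
by rewrite subr_eq [k + _]addrC subrK.
Qed.

Lemma rank_le2 : (\rank (T 0%R) <= 2)%N.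
Proof.
pose K : 'M[F]_N := (\bigcap_(j | (j != 0%R) && (j != - 1)) kermx (T j))%MS.
have [K0|/rowV0Pn [e /sub_bigcapmxP eK e0]] := eqVneq K 0; last first.
  have {}eK j : j != 0 -> j != - 1 -> e *m T j = 0.
    by move=> j0 j1; apply/sub_kermxP/eK; rewrite j0.
  pose v (i : 'I_N) := e *m t ^+ i.
  have vT i k : i != k -> i != k + 1 -> v i *m T k = 0.
    move=> ik ik1; rewrite /v rotI eK ?mul0mx //.
      by rewrite subr_eq0 eq_sym.
    by rewrite subr_eq [- 1 + _]addrC eq_sym subr_eq.
  apply: (rank_le2_of_killed 0 vT) => k; apply/eqP => vk.
  suff /eqP : v (k + 1) = 0 by rewrite mul_tX_eq0 (negPf e0).
  apply: (@killed_by_all_but_one _ (k + 1)) => j jk1.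
  have [->//|jk] := eqVneq j k.
  by apply: vT; rewrite eq_sym ?(inj_eq (addIr 1)).
(* Rotating by [- k] moves the exceptional pair [k], [k - 1] to [0], [- 1], the pair defining
   [K]. *)
have noK (x : 'rV[F]_N) k :
    (forall j, j != k -> j != k - 1 -> x *m T j = 0) -> x = 0.
  move=> xT; apply/eqP; rewrite -(mul_tX_eq0 _ (- k)%R) -submx0 -K0.
  apply/sub_bigcapmxP => j /andP [j0 j1]; apply/sub_kermxP.
  rewrite rotI xT ?mul0mx // opprK; first by rewrite -subr_eq0 addrK.
  by rewrite [k - 1]addrC (inj_eq (addIr k)).
rewrite leqNgt; apply/negP => rk3.
pose w (i : 'I_N) := w0 *m t ^+ i.
have w_neq0 i : w i != 0 by rewrite mul_tX_eq0.
have wT i j : far i j -> w i *m T j = 0.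
  by move/(far_sub i); rewrite subrr /w rotI => /kill ->; rewrite mul0mx.
apply: (@not_all_rank3 _ _ T comm_far _ w mu wT).
- by move=> U U0 inv; apply: irr.
- by move=> i; rewrite /w rotI subrr eigen scalemxAl.
(* If this product vanished, only [T (i + 1)] and [T (i + 2)] could act nontrivially on [w (i + 1)],
   against [noK]. *)
- move=> i; apply/eqP => h; apply/negP: (w_neq0 (i + 1)); rewrite negbK; apply/eqP.
  apply: (@noK _ (i + 1 + 1)) => j; rewrite addrK => j1 j2.
  have [->//|ji] := eqVneq j i; apply: wT.
  by rewrite /far eq_sym j2 (inj_eq (addIr 1)) eq_sym ji.
- move=> i; apply/eqP => h; apply/negP: (w_neq0 i); rewrite negbK; apply/eqP.
  apply: (@noK _ i) => j j1 j2.
  have [->//|ji] := eqVneq j (i + 1); apply: wT.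
  by rewrite /far eq_sym j1 ji andbT -subr_eq eq_sym.
- by move=> j; rewrite rank_rot.
Qed.

End Rotation.

(** * Cyclic extension of the Artin generators *)

Section Rotor.
Context (R : unitRingType) (n : nat) (a : nat -> R).
Hypothesis a_unit : forall i, (1 <= i <= n)%N -> a i \is a GRing.unit.
Hypothesis braid : forall i, (1 <= i)%N -> (i.+1 <= n)%N ->
  a i * a i.+1 * a i = a i.+1 * a i * a i.+1.
Hypothesis comm : forall i j, (1 <= i)%N -> (j <= n)%N -> (i.+1 < j)%N ->
  a i * a j = a j * a i.

Fixpoint desc_prod (b : nat -> R) k :=
  if k is k'.+1 then b k * desc_prod b k' else 1.

Let q := desc_prod a.
Let t := q n.

Let comm_q j k : (j <= n)%N -> (k.+1 < j)%N -> a j * q k = q k * a j.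
Proof.
move=> jn; elim: k => [|k IH] kj; first by rewrite mulr1 mul1r.
rewrite /q /= -/(q k) mulrA -comm //.
by rewrite -!mulrA IH // ltnW.
Qed.

(** [a i] commutes past the factors above [a i.+1], becomes [a i.+1] by the braid relation, then
    commutes past those below [a i]. *)
Let q_shift i k : (1 <= i < k)%N -> (k <= n)%N -> a i * q k = q k * a i.+1.
Proof.
elim: k => [|k IH] /andP [i1 ik] kn; first by [].
rewrite /q /= -/(q k) -[RHS]mulrA; have [e|lt_ik] := eqVneq i k.
  case: k e => [|k] e in IH ik kn *; first by rewrite e in i1.
  rewrite e /q /= -/(q k) !mulrA braid // -!mulrA; congr (_ * (_ * _)).
  by rewrite comm_q.
have {}lt_ik : (i < k)%N by rewrite ltn_neqAle lt_ik.
by rewrite mulrA comm // -mulrA IH ?i1 // ltnW.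
Qed.

Let q_split k : q k.+1 = desc_prod (fun i => a i.+1) k * a 1%N.
Proof.
elim: k => [|k IH]; first by rewrite /q /= mulr1 mul1r.
by rewrite (_ : q k.+2 = a k.+2 * q k.+1) // IH mulrA.
Qed.

Let q_shift_prod k : (k < n)%N -> q k * t = t * desc_prod (fun i => a i.+1) k.
Proof.
elim: k => [|k IH] kn; first by rewrite mulr1 mul1r.
rewrite /q /= -/(q k) -mulrA IH 1?ltnW // !mulrA; congr (_ * _).
exact: q_shift.
Qed.

(** The relation that closes the circle: peel [a n] off the left of one [t] and [a 1] off the right
    of another, and shift what remains by [q_shift_prod]. *)
Let t2 : (0 < n)%N -> a n * t ^+ 2 = t ^+ 2 * a 1%N.
Proof.
move=> n0; rewrite expr2.
have e1 : t = a n * q n.-1 by rewrite /t -(prednK n0).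
have e2 : t = desc_prod (fun i => a i.+1) n.-1 * a 1%N.
  by rewrite /t -{1}(prednK n0) q_split.
transitivity (a n * (q n.-1 * t) * a 1%N); last by rewrite mulrA -e1.
by rewrite q_shift_prod ?prednK // -!mulrA -e2.
Qed.

Let t_unit : t \is a GRing.unit.
Proof.
rewrite /t; elim: {-2}n (leqnn n) => [|k IH] kn; first exact: unitr1.
by rewrite /q /= -/(q k) unitrMr ?a_unit // IH // ltnW.
Qed.

(* The witness is [t = a n * ... * a 1]; note the index shift [S i = a i.+1]. *)
Lemma rotation : (0 < n)%N -> exists (t : R) (S : nat -> R),
  [/\ t \is a GRing.unit, forall i, S i * t = t * S i.+1,
      forall i, S (i + n.+1)%N = S i & forall i, (i < n)%N -> S i = a i.+1].
Proof.
move=> n0; pose S i := t ^- i * a 1%N * t ^+ i.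
have St i : S i * t = t * S i.+1.
  by rewrite /S exprSr invrM ?unitrX // -!mulrA mulVKr.
have Sa i : (i < n)%N -> S i = a i.+1.
  elim: i => [|i IH] lt_in; first by rewrite /S invr1 mulr1 mul1r.
  apply: (mulrI t_unit); rewrite -St IH 1?ltnW //.
  exact: q_shift.
(* Two shifts lead from [S n.+1] back to [a n], and [t2] takes [a n] to [a 1]. *)
have S0 : S n.+1 = S 0%N.
  apply: (mulrI (unitrX 2 t_unit)).
  rewrite [S 0%N]Sa // -t2 // expr2 -[LHS]mulrA -St mulrA -[in S n](prednK n0).
  by rewrite -St Sa prednK // mulrA.
exists t, S; split=> //; elim=> [|i IH] //.
by apply: (mulrI t_unit); rewrite -!St IH.
Qed.
End Rotor.

(** * From the braid representation to the cyclic family *)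

Theorem theorem2 (n : nat) (A : nat -> 'M[C]_(n.+1)) :
  (4 <= n)%N ->
  braid_rep n A ->
  braid_rep_irreducible n A ->
  (exists v : 'cV[C]_(n.+1), v != 0 /\
     forall i : nat, (1 <= i <= n)%N -> i != n.-1 ->
       exists c : C, A i *m v = c *: v) ->
  exists y : C, y != 0 /\ \rank (A 1%N - y%:M) = 2%N.
Proof.
move=> n4; case: n n4 A => [//|[//|[//|[//|m]]]] _ A.
move=> [A_unit A_braid A_comm] A_irr [v [v0 v_inv]].
pose a i : 'M[C]_(m.+4.+1) := (A i)^T.
have a_unit i : (1 <= i <= m.+4)%N -> a i \is a GRing.unit.
  by move=> /A_unit; rewrite -unitmx_tr.
have a_braid i : (1 <= i)%N -> (i.+1 <= m.+4)%N ->
    a i * a i.+1 * a i = a i.+1 * a i * a i.+1.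
  by move=> h1 h2; rewrite /a -!mulmxE -!trmx_mul !mulmxA A_braid.
have a_comm i j : (1 <= i)%N -> (j <= m.+4)%N -> (i.+1 < j)%N ->
    a i * a j = a j * a i.
  by move=> h1 h2 h3; rewrite /a -!mulmxE -!trmx_mul (A_comm i j).
pose x : 'rV[C]_(m.+4.+1) := v^T.
have x0 : x != 0 by rewrite /x trmx_eq0.
have x_eigen i : (1 <= i <= m.+4)%N -> i != m.+3 ->
    exists c, x *m a i = c *: x.
  move=> h1 h2; have [c e] := v_inv i h1 h2; exists c.
  by rewrite /x /a -trmx_mul e linearZ.
have ev_neq0 i c : (1 <= i <= m.+4)%N -> x *m a i = c *: x -> c != 0.
  move=> hi e; apply: contraNneq x0 => c0.
  rewrite -(mulmxK (a_unit i hi) x) e c0 scale0r mul0mx //.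
(* The braid relation applied to [x] gives [y * c * (y - c) = 0] for consecutive eigenvalues, both
   nonzero. *)
have [y y_eigen] : exists y, forall i, (i <= m.+1)%N -> x *m a i.+1 = y *: x.
  have [y ey] := x_eigen 1%N isT isT; exists y; elim=> [//|i IH] hi.
  have /IH {IH} ei : (i <= m.+1)%N by lia.
  have [c ec] : exists c, x *m a i.+2 = c *: x by apply: x_eigen; lia.
  have y0 : y != 0 by apply: ev_neq0 ey.
  have c0 : c != 0 by apply: ev_neq0 ec; lia.
  have : (1 <= i.+1)%N by []; move/a_braid => /(_ ltac:(lia)).
  move/(congr1 (mulmx x)); rewrite -!mulmxE !mulmxA.
  do 3 rewrite ?ei ?ec -?scalemxAl; rewrite !scalerA => /eqP.
  rewrite -subr_eq0 -scalerBl scaler_eq0 (negPf x0) orbF.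
  rewrite (_ : _ - _ = y * c * (y - c)); last by ring.
  by rewrite !mulf_eq0 (negPf y0) (negPf c0) subr_eq0 => /eqP ->.
have [mu mu_eigen] : exists mu, x *m a m.+4 = mu *: x.
  by apply: x_eigen; lia.
have y0 : y != 0 by apply: (@ev_neq0 1%N) => //; apply: y_eigen.
have [t [S [t_unit St Sper Sa]]] := rotation a_unit a_braid a_comm isT.
pose T (i : 'I_m.+4.+1) : 'M[C]_(m.+4.+1) := S i - y%:M.
have Smod i : S (i %% m.+4.+1)%N = S i.
  rewrite [in RHS](divn_eq i m.+4.+1) addnC.
  elim: (i %/ _)%N => [|k ->]; first by rewrite addn0.
  by rewrite mulSnr addnA Sper.
have Tt i : T i *m t = t *m T (i + 1).
  rewrite /T mulmxBl mulmxBr scalar_mxC; congr (_ - _).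
  by rewrite /= Smod addn1 mulmxE St.
have Ta i : (i < m.+4)%N -> T i%:R = a i.+1 - y%:M.
  by move=> hi; rewrite /T Zp_nat /= Smod Sa.
have Tirr (U : 'M[C]_(m.+4.+1)) : U != 0 ->
    (forall j : 'I_m.+4.+1, j != - 1 -> U *m T j <= U)%MS -> \rank U = m.+4.+1.
  move=> U0 UT; have := A_irr U; rewrite mxrank_eq0 (negPf U0) /= => h.
  apply/eqP/h => i /andP [i1 ilt]; rewrite /col_invariant.
  case: i i1 ilt => [//|i] _ ilt.
  have -> : (A i.+1)^T = T i%:R + y%:M by rewrite Ta // subrK.
  rewrite mulmxDr addmx_sub // ?UT ?mul_mx_scalar ?scalemx_sub //.
  rewrite -[_ == _](inj_eq (addIr 1)) addNr natr1 -[i.+1%:R]add0r.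
  rewrite -[0 in X in _ != X]addr0.
  by rewrite eq_sym; apply: (@Zp_shift_neq _ 0 0 i.+1).
have T0a : T 0 = a 1%N - y%:M by rewrite -(Ta 0%N).
exists y; split=> //.
have <- : \rank (T 0) = \rank (A 1%N - y%:M).
  by rewrite T0a -mxrank_tr linearB /= trmxK tr_scalar_mx.
have far0 (k : 'I_m.+4.+1) : far 0 k -> (1 < k < m.+4)%N.
  case/and3P => k0 k1; rewrite add0r => k2.
  have kn0 : val k != 0%N.
    by apply: contraNneq k0 => e; apply/eqP/val_inj.
  have kn1 : val k != 1%N.
    by apply: contraNneq k2 => e; apply/eqP/val_inj.
  have kn2 : val k != m.+4.
    by apply: contraNneq k1 => e; apply/eqP/val_inj; rewrite /= e addn1 modnn.
  by have := ltn_ord k; move: kn0 kn1 kn2 => /=; lia.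
have Tt2 i : x *m t ^+ 2 *m T (i + 1 + 1) = x *m T i *m t ^+ 2.
  by rewrite expr2 -mulmxE -!mulmxA -Tt (mulmxA t) -Tt -!mulmxA.
apply/eqP; rewrite eqn_leq (rank_gt1 _ Tt) // andbT.
(* [x] is killed by [T 0], ..., [T m.+1] and is an eigenvector of [T m.+3]. Two rotations move these
   indices to [2], ..., [m.+3], exactly those far from [0], and to [m.+5], which is [0]. *)
apply: (@rank_le2 _ _ T t t_unit Tt Tirr _ (x *m t ^+ 2) (mu - y)).
- move=> k /far0 /andP [k1 k2].
  have cy (z : 'M[C]_(m.+4.+1)) : GRing.comm z y%:M.
    by rewrite /GRing.comm -!mulmxE scalar_mxC.
  rewrite -[k]natr_Zp Ta // T0a; apply: commrB => //.
  by apply/commr_sym/commrB => //; apply/commr_sym/a_comm.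
- apply: contraNneq x0 => h.
  by rewrite -[x](mulmxK (unitrX 2 t_unit : _ \in unitmx)) h mul0mx.
- move=> k /far0 /andP [k1 k2].
  have -> : k = (k - 2)%N%:R + 1 + 1.
    by rewrite !natr1 -subSn // -subSn ?subSS ?subn0 ?natr_Zp //; lia.
  by rewrite Tt2 Ta ?mulmxBr ?y_eigen ?mul_mx_scalar ?subrr ?mul0mx //; lia.
- have -> : 0 = m.+3%:R + 1 + 1 :> 'I_m.+4.+1.
    by rewrite !natr1; apply/val_inj; rewrite Zp_nat /= modnn.
  by rewrite Tt2 Ta // mulmxBr mu_eigen mul_mx_scalar -scalerBl -scalemxAl.
Qed.
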